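(* The number of pairs $(x,y)$ of imaginary octonions such that $\frac12+x,\ y\in\mathfrak{o}$, $(\frac12+\bar x)y$ is an imaginary octonion, $N(\frac12+x)=1$ and $N(y)=1$, is $4032$.
   Context: $\mathfrak{C}_{\mathbb{Q}}=\bigoplus_{i=0}^7\mathbb{Q}e_i$ is the algebra of octonions (Cayley numbers): $e_0$ is the unit, and $e_i^2=-e_0$, $e_i(e_{i+1}e_{i+3})=(e_ie_{i+1})e_{i+3}=-e_0$ for $1\le i\le 7$ (indices modulo $7$ in $\{1,\dots,7\}$), the span of $e_0,e_i,e_{i+1},e_{i+3}$ being a quaternion algebra; $\frac12$ means $\frac12e_0$. For $x=\sum_{i=0}^7x_ie_i$ put $\bar x=2x_0e_0-x$ and $N(x)=\sum_{i=0}^7x_i^2$; $x$ is called imaginary if $x_0=0$. The lattice $\mathfrak{o}\subset\mathfrak{C}_{\mathbb{Q}}$ of integral octonions is the $\mathbb{Z}$-span of $\alpha_0=e_0$, $\alpha_1=e_1$, $\alpha_2=e_2$, $\alpha_3=-e_4$, $\alpha_4=\frac12(e_1+e_2+e_3+e_4)$, $\alpha_5=\frac12(-e_0-e_1-e_4+e_5)$, $\alpha_6=\frac12(-e_0+e_1-e_2+e_6)$, $\alpha_7=\frac12(-e_0+e_2+e_4+e_7)$. *)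

(* Defs.v *)
From mathcomp Require Import all_boot all_order all_algebra.

Set Implicit Arguments.
Unset Strict Implicit.
Unset Printing Implicit Defensive.

Import Order.TTheory GRing.Theory Num.Theory.
Local Open Scope ring_scope.

(* Representative in {1, ..., 7} of the index m modulo 7, for 0 < m. *)
Definition idx7 (m : nat) : nat := (m.-1 %% 7).+1.

(* (i, j, k) is, up to cyclic permutation, one of the triples (m, m+1, m+3).
   In the quaternion algebra spanned by e_0, e_m, e_(m+1), e_(m+3), the
   relations e_m (e_(m+1) e_(m+3)) = (e_m e_(m+1)) e_(m+3) = -e_0 say that
   e_i e_j = e_k = - e_j e_i for these triples. *)
Definition quaternion_triple (i j k : nat) : bool :=
  has (fun m => let n := idx7 (m + 1) in let p := idx7 (m + 3) in
         (i, j, k) \in [:: (m, n, p); (n, p, m); (p, m, n)])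
      (iota 1 7).

(* The coefficient of e_k in e_i e_j. *)
Definition oct_coef (i j k : nat) : int :=
  if i == 0%N then (k == j)%:R
  else if j == 0%N then (k == i)%:R
  else if i == j then - (k == 0%N)%:R
  else (quaternion_triple i j k)%:R - (quaternion_triple j i k)%:R.

(* x stands for the sum over i of (x 0 i) e_i. *)
Definition octonion : Type := 'rV[rat]_8.

Definition oct_e (i : nat) : octonion := \row_(k < 8) (k == i :> nat)%:R.

Definition oct_mul (x y : octonion) : octonion :=
  \row_(k < 8) \sum_(i < 8) \sum_(j < 8) (oct_coef i j k)%:~R * x 0 i * y 0 j.

Definition oct_conj (x : octonion) : octonion := (2 * x 0 0) *: oct_e 0 - x.

Definition oct_norm (x : octonion) : rat := \sum_(i < 8) x 0 i ^+ 2.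

Definition oct_imaginary (x : octonion) : Prop := x 0 0 = 0.

Definition oct_half : octonion := 2^-1 *: oct_e 0.

Definition oct_alpha : 8.-tuple octonion :=
  [tuple oct_e 0;
         oct_e 1;
         oct_e 2;
         - oct_e 4;
         2^-1 *: (oct_e 1 + oct_e 2 + oct_e 3 + oct_e 4);
         2^-1 *: (- oct_e 0 - oct_e 1 - oct_e 4 + oct_e 5);
         2^-1 *: (- oct_e 0 + oct_e 1 - oct_e 2 + oct_e 6);
         2^-1 *: (- oct_e 0 + oct_e 2 + oct_e 4 + oct_e 7)].

Definition oct_integral (x : octonion) : Prop := inIntSpan oct_alpha x.

Lemma oct_mul_e (i j : nat) : (i < 8)%N -> (j < 8)%N ->
  oct_mul (oct_e i) (oct_e j) = \row_(k < 8) (oct_coef i j k)%:~R.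
Proof.
move=> lti ltj; apply/rowP => k; rewrite !mxE.
rewrite (bigD1 (Ordinal lti)) //= [X in _ + X]big1 ?addr0; last first.
  move=> a nai; apply: big1 => b _; rewrite !mxE.
  by rewrite (negPf (nai : (a : nat) != i)) mulr0 mul0r.
rewrite (bigD1 (Ordinal ltj)) //= big1 ?addr0; last first.
  by move=> b nbj; rewrite !mxE (negPf (nbj : (b : nat) != j)) mulr0.
by rewrite !mxE !eqxx !mulr1.
Qed.

Lemma oct_mul_coefl (f : nat -> int) (j : nat) : (j < 8)%N ->
  oct_mul (\row_(k < 8) (f k)%:~R) (oct_e j) =
  \row_(k < 8) (\sum_(l < 8) oct_coef l j k * f l)%:~R.
Proof.
move=> ltj; apply/rowP => k; rewrite !mxE rmorph_sum; apply: eq_bigr => l _.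
rewrite (bigD1 (Ordinal ltj)) //= big1 ?addr0; last first.
  by move=> b nbj; rewrite !mxE (negPf (nbj : (b : nat) != j)) mulr0.
by rewrite !mxE eqxx mulr1 intrM.
Qed.

Lemma oct_mul_coefr (f : nat -> int) (i : nat) : (i < 8)%N ->
  oct_mul (oct_e i) (\row_(k < 8) (f k)%:~R) =
  \row_(k < 8) (\sum_(l < 8) oct_coef i l k * f l)%:~R.
Proof.
move=> lti; apply/rowP => k; rewrite !mxE rmorph_sum exchange_big.
apply: eq_bigr => l _.
rewrite (bigD1 (Ordinal lti)) //= big1 ?addr0; last first.
  move=> b nbi; rewrite !mxE.
  by rewrite (negPf (nbi : (b : nat) != i)) mulr0 mul0r.
by rewrite !mxE eqxx mulr1 intrM.
Qed.

Lemma oct_e_sqr (i : nat) : (0 < i < 8)%N ->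
  oct_mul (oct_e i) (oct_e i) = - oct_e 0.
Proof.
case/andP=> i_gt0 lti; rewrite oct_mul_e //; apply/rowP => k.
by rewrite !mxE /oct_coef eqn0Ngt i_gt0 eqxx /= rmorphN /= rmorph_nat.
Qed.

Lemma oct_e_triple (i : nat) : (0 < i < 8)%N ->
  oct_mul (oct_e i) (oct_mul (oct_e (idx7 (i + 1))) (oct_e (idx7 (i + 3))))
    = - oct_e 0 /\
  oct_mul (oct_mul (oct_e i) (oct_e (idx7 (i + 1)))) (oct_e (idx7 (i + 3)))
    = - oct_e 0.
Proof.
move=> /andP[i_gt0 lti]; have lt7 m : (idx7 m < 8)%N by rewrite ltnS ltn_pmod.
rewrite !oct_mul_e // oct_mul_coefl // oct_mul_coefr //.
have E (k : 'I_8) :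
  - (k == 0%N :> nat)%:R = (- (k == 0%N :> nat)%:R : int)%:~R :> rat.
  by rewrite rmorphN /= rmorph_nat.
pose s f : int := foldr (fun l r => f l + r) 0 (iota 0 8).
pose test i k : bool :=
  (s (fun l => oct_coef i l k * oct_coef (idx7 (i + 1)) (idx7 (i + 3)) l)
     == - (k == 0%N)%:R) &&
  (s (fun l => oct_coef l (idx7 (i + 3)) k * oct_coef i (idx7 (i + 1)) l)
     == - (k == 0%N)%:R).
have : all (fun i => all (test i) (iota 0 8)) (iota 1 7) by vm_compute.
move/allP/(_ i); rewrite mem_iota i_gt0 => /(_ lti)/allP T.
split; apply/rowP => k; rewrite !mxE E; congr _%:~R;
  rewrite !big_ord_recl big_ord0 /=;
  have := T (k : nat); rewrite mem_iota ltn_ord => /(_ isT)/andP[/eqP Tl /eqP Tr].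
  exact: Tl.
exact: Tr.
Qed.

(* The span of e_0, e_i, e_(i+1), e_(i+3) is associative. *)
Lemma oct_e_assoc (i a b c : nat) : (0 < i < 8)%N ->
    let q := [:: 0; i; idx7 (i + 1); idx7 (i + 3)]%N in
    a \in q -> b \in q -> c \in q ->
  oct_mul (oct_e a) (oct_mul (oct_e b) (oct_e c)) =
  oct_mul (oct_mul (oct_e a) (oct_e b)) (oct_e c).
Proof.
move=> i_bnd q qa qb qc.
have q_lt d : d \in q -> (d < 8)%N.
  case/andP: i_bnd => _ lti; rewrite !inE.
  by case/or4P=> /eqP-> //; rewrite ltnS ltn_pmod.
rewrite !oct_mul_e ?oct_mul_coefl ?oct_mul_coefr ?q_lt //.
apply/rowP => k; rewrite !mxE; congr _%:~R; rewrite !big_ord_recl !big_ord0 /=.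
pose s f : int := foldr (fun l r => f l + r) 0 (iota 0 8).
pose test a b c k : bool :=
  s (fun l => oct_coef a l k * oct_coef b c l) ==
  s (fun l => oct_coef l c k * oct_coef a b l).
pose Q i := [:: 0; i; idx7 (i + 1); idx7 (i + 3)]%N.
have : all (fun i => all (fun a => all (fun b => all (fun c =>
         all (fun k => test a b c k) (iota 0 8)) (Q i)) (Q i)) (Q i)) (iota 1 7).
  by vm_compute.
move/allP/(_ i); rewrite mem_iota => /(_ i_bnd)/allP/(_ a qa)/allP/(_ b qb).
move/allP/(_ c qc)/allP/(_ (k : nat)); rewrite mem_iota ltn_ord => /(_ isT)/eqP.
exact.
Qed.

(* Main.v *)
Require Import Defs.
From mathcomp Require Import all_boot all_order all_algebra.
From mathcomp Require Import classical_sets cardinality.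
From mathcomp Require Import ring lra zify.
Import Order.TTheory GRing.Theory Num.Theory.
Local Open Scope ring_scope.
Local Open Scope classical_set_scope.
Local Open Scope card_scope.

(** Put z = 1/2 + x.  Since 1/2 + conj x = conj z, and the real part of
    (conj z) y is the Euclidean inner product of z and y ([re_conj_mul]), the
    pairs to be counted are the pairs (z, y) of integral octonions of norm 1
    such that z has real part 1/2 and y is orthogonal to both e_0 and z.

    The lattice of integral octonions is a copy of the root lattice E_8 whose
    240 roots are its elements of norm 1.  The roots z with inner product 1/2
    with the root e_0 are 56 in number; e_0 and z then span a lattice A_2, and
    the roots orthogonal to it form a system E_6, which has 72 elements.  Hence
    the number of pairs is 56 * 72 = 4032.

    The two numbers 56 and 72 are obtained here by enumeration
    ([size_partners]).  To make the roots computable, octonions are replaced by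
    their doubled coordinates: an integral octonion is half of an integer
    vector that satisfies four parity conditions ([oct_integralP]), and it has
    norm 1 exactly when the integer vector has norm 4, so that the roots lie
    among the finitely many integer vectors of norm 4 ([integral_unitP]). *)

(** * Doubled coordinates *)

Definition halves (v : seq int) : octonion := \row_(k < 8) ((v`_k)%:~R / 2).

(** The inner product on Z^8 is written as a fold over a list because a big sum
    over ordinals is locked and would block the enumeration below. *)
Definition dot (u v : seq int) : int :=
  foldr +%R 0 [seq u`_i * v`_i | i <- iota 0 8].

(** The residue of v modulo 2 lies in the extended Hamming code spanned by the
    supports of alpha_4, ..., alpha_7.  The signs are chosen so that these four
    numbers are the doubles of the coordinates of [halves v] on alpha_0, ...,
    alpha_3. *)
Definition in_code (v : seq int) : bool :=
  all (dvdz 2)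
    [:: v`_0 + v`_5 + v`_6 + v`_7; v`_1 - v`_3 + v`_5 - v`_6;
        v`_2 - v`_3 + v`_6 - v`_7; v`_3 - v`_4 - v`_5 + v`_7].

Lemma halves_inj (u v : seq int) :
  size u = 8%N -> size v = 8%N -> halves u = halves v -> u = v.
Proof.
move=> su sv /rowP eq_uv.
apply: (eq_from_nth (x0 := 0)); rewrite su ?sv // => i lti.
have := eq_uv (Ordinal lti); rewrite !mxE /= => eq_i.
by apply: (intr_inj (R := rat)); lra.
Qed.

Lemma re_halves (v : seq int) (c : int) :
  halves v 0 0 = c%:~R / 2 <-> v`_0 = c.
Proof.
by rewrite mxE; split=> [eq_c|-> //]; apply: (intr_inj (R := rat)); lra.
Qed.

Lemma dot_halves (u v : seq int) :
  \sum_(i < 8) halves u 0 i * halves v 0 i = (dot u v)%:~R / 4.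
Proof.
rewrite /dot foldrE big_map -[iota 0 8]/(index_iota 0 8) big_mkord rmorph_sum.
by rewrite mulr_suml; apply: eq_bigr => i _; rewrite !mxE rmorphM /=; field.
Qed.

Lemma dot_diag (v : seq int) :
  size v = 8%N -> dot v v = (sumn [seq `|c|%N ^ 2 | c : int <- v]%N)%:Z.
Proof.
move=> sv; rewrite /dot foldrE sumnE !big_map [in RHS](big_nth 0) sv.
rewrite (big_morph Posz PoszD (erefl 0%:Z)); apply: eq_bigr => i _.
by rewrite -mulnn PoszM !abszE -normrM ger0_norm // -expr2 sqr_ge0.
Qed.

(** The basis alpha is triangular enough to be inverted by hand: the doubled
    coordinates 3, 5, 6, 7 of an octonion are its coordinates on alpha_4, ...,
    alpha_7, and the other four then follow up to a division by 2, which is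
    what [in_code] makes possible. *)
Lemma oct_integralP z :
  oct_integral z <-> exists v, [/\ size v = 8%N, in_code v & z = halves v].
Proof.
have span_row (a : seq int) : \sum_(i < 8) oct_alpha`_i *~ a`_i =
    halves [:: 2 * a`_0 - a`_5 - a`_6 - a`_7; 2 * a`_1 + a`_4 - a`_5 + a`_6;
      2 * a`_2 + a`_4 - a`_6 + a`_7; a`_4; - 2 * a`_3 + a`_4 - a`_5 + a`_7;
      a`_5; a`_6; a`_7].
  apply/rowP => k; rewrite !big_ord_recl big_ord0 /= -!scaler_int !mxE.
  by case: k => -[|[|[|[|[|[|[|[|//]]]]]]]] /= _;
     rewrite ?mxE /= ?(rmorphD, rmorphN, rmorphM) /=; field.
split.
  case=> a; rewrite (eq_bigr (fun i : 'I_8 => oct_alpha`_i *~ (codom a)`_i)).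
    rewrite span_row => ->; eexists; split; last by [].
      by [].
    by rewrite /in_code /=; lia.
  move=> i _; congr (_ *~ _).
  by rewrite /codom (nth_map i) ?size_enum_ord // nth_ord_enum.
case=> v [sv /and5P[/dvdzP[a0 E0] /dvdzP[a1 E1] /dvdzP[a2 E2] /dvdzP[a3 E3] _]].
move=> ->; pose a := [:: a0; a1; a2; a3; v`_3; v`_5; v`_6; v`_7].
exists [ffun i : 'I_8 => a`_i]; under eq_bigr do rewrite ffunE.
rewrite span_row; congr halves.
case: v sv E0 E1 E2 E3 @a
  => [//|v0[//|v1[//|v2[//|v3[//|v4[//|v5[//|v6[//|v7[]//]]]]]]]] _ /=.
by move=> E0 E1 E2 E3; congr [:: _; _; _; _; _; _; _; _]; lia.
Qed.

(** * The real part of (conj z) y *)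

Lemma oct_coef_re i j : (i < 8)%N -> (j < 8)%N ->
  oct_coef i j 0 = (if i == 0%N then 1 else -1) * (i == j)%:R.
Proof.
move=> lti ltj.
have : all (fun i => all (fun j =>
  oct_coef i j 0 == (if i == 0%N then 1 else -1) * (i == j)%:R)
  (iota 0 8)) (iota 0 8) by vm_compute.
move=> /allP/(_ i) /[!mem_iota] /(_ lti).
by move=> /allP/(_ j) /[!mem_iota] /(_ ltj) /eqP.
Qed.

(** Among the products e_i e_j only the squares have a real part, and the sign
    of that of e_i e_i is the one that conjugation gives to e_i. *)
Lemma re_conj_mul (z y : octonion) :
  oct_mul (oct_conj z) y 0 0 = \sum_(i < 8) z 0 i * y 0 i.
Proof.
rewrite mxE; apply: eq_bigr => i _.
rewrite (bigD1 i) //= big1 => [|j /negPf nij].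
  rewrite addr0 oct_coef_re // eqxx !mxE; case: eqP => [i0|_].
    have -> : i = 0 by apply: val_inj.
    by rewrite /=; ring.
  by rewrite rmorphM rmorphN /=; ring.
have nij_nat : (i == j :> nat) = false by rewrite eq_sym.
by rewrite oct_coef_re // nij_nat mulr0 !mul0r.
Qed.

Lemma half_conj x : oct_half + oct_conj x = oct_conj (oct_half + x).
Proof. by apply/rowP => k; rewrite !mxE /=; field. Qed.

(** * Enumeration of the roots *)

Definition signed_range (n : nat) : seq int :=
  [seq i%:Z | i <- iota 0 n.+1] ++ [seq - i%:Z | i <- iota 1 n].

(** Choosing the entries one at a time, against what remains of the squared
    length N, keeps the enumeration small enough to be run. *)
Fixpoint sphere (n N : nat) : seq (seq int) :=
  if n is n'.+1 then
    [seq c :: v | c <- [seq c <- signed_range N | (`|c| ^ 2 <= N)%N],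
                  v <- sphere n' (N - `|c| ^ 2)]
  else if N is 0 then [:: [::]] else [::].

Lemma sphereP n N v : v \in sphere n N <->
  size v = n /\ sumn [seq `|c|%N ^ 2 | c : int <- v]%N = N.
Proof.
elim: n N v => [|n IHn] N v.
  by case: v => [|c v]; case: N => [|N]; split=> // -[].
split.
  case/allpairsPdep => c [w [/[!mem_filter]/andP[c_le _] /IHn[sw nw] ->]].
  by rewrite /= sw nw subnKC.
case: v => [[]//|c v [[sv] nv]]; rewrite /= in nv.
apply/allpairsPdep; exists c, v; split=> //; last by apply/IHn; split=> //; lia.
rewrite mem_filter -nv leq_addr /= mem_cat.
(* The range is wide enough because an integer is bounded by its square. *)
have c_le : (`|c| <= `|c| ^ 2 + sumn [seq `|c|%N ^ 2 | c : int <- v])%N by nia.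
case: (lerP 0 c) => c0; apply/orP; [left|right]; apply/mapP; exists `|c|%N;
  rewrite ?mem_iota; lia.
Qed.

(** The 240 roots, in doubled coordinates, whence the squared length 4. *)
Definition roots : seq (seq int) := [seq v <- sphere 8 4 | in_code v].

Definition roots_re_half : seq (seq int) := [seq u <- roots | u`_0 == 1].

(** The roots orthogonal to e_0 and u: the system E_6 attached to u. *)
Definition partners (u : seq int) : seq (seq int) :=
  [seq v <- roots | (v`_0 == 0) && (dot u v == 0)].

Lemma roots_uniq : uniq roots.
Proof. by vm_compute. Qed.

Lemma size_root v : v \in roots -> size v = 8%N.
Proof. by rewrite mem_filter => /andP[_ /sphereP[]]. Qed.

Lemma size_partners :
  [seq size (partners u) | u <- roots_re_half] = nseq 56 72%N.
Proof. by vm_compute. Qed.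

Lemma integral_unitP z :
  oct_integral z /\ oct_norm z = 1 <-> exists2 v, v \in roots & z = halves v.
Proof.
have norm_halves v : oct_norm (halves v) = (dot v v)%:~R / 4.
  by rewrite -dot_halves; apply: eq_bigr => i _; rewrite expr2.
split=> [[/oct_integralP[v [sv cv ->]]]|[v]].
  rewrite norm_halves => nv; exists v => //; rewrite mem_filter cv.
  apply/sphereP; split=> //; suff: dot v v = 4 by rewrite dot_diag // => -[].
  by apply: (intr_inj (R := rat)); lra.
rewrite mem_filter => /andP[cv /sphereP[sv nv]] ->; split.
  by apply/oct_integralP; exists v.
by rewrite norm_halves dot_diag // nv divff.
Qed.

(** * The count *)

Lemma card_eq_seq (T : choiceType) (s : seq T) :
  uniq s -> [set` s] #= `I_(size s).
Proof.
move=> s_uniq; apply/card_set_bijP; exists (index^~ s); split.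
- by move=> x; rewrite /= index_mem.
- move=> x y; rewrite !inE /= => xs ys eq_i.
  by rewrite -(nth_index x xs) eq_i nth_index.
- move=> i /= lti; have x0 : T by case: s lti {s_uniq} => [|x].
  by exists (nth x0 s i); rewrite /= ?mem_nth // index_uniq.
Qed.

(** The first component is x = z - 1/2, where z runs over the roots of real
    part 1/2. *)
Definition solutions : seq (octonion * octonion) :=
  [seq (halves u - oct_half, halves v) | u <- roots_re_half, v <- partners u].

Lemma size_solutions : size solutions = 4032%N.
Proof. by rewrite size_allpairs_dep size_partners. Qed.

Lemma solutions_uniq : uniq solutions.
Proof.
have uniq_filter p : uniq [seq v <- roots | p v].
  exact: filter_uniq roots_uniq.
have size8 p w : w \in [seq v <- roots | p v] -> size w = 8%N.
  by rewrite mem_filter => /andP[_]; exact: size_root.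
apply: allpairs_uniq_dep => [|u _|]; [exact: uniq_filter|exact: uniq_filter|].
move=> _ _ /allpairsPdep[u [v [uU vV ->]]] /allpairsPdep[u' [v' [uU' vV' ->]]].
case=> /= /addIr/halves_inj eq_u /halves_inj eq_v.
rewrite (eq_u (size8 _ _ uU) (size8 _ _ uU')).
by rewrite (eq_v (size8 _ _ vV) (size8 _ _ vV')).
Qed.

Theorem proposition3p8 :
  [set p : octonion * octonion |
    let: (x, y) := p in
    (oct_imaginary x /\ oct_imaginary y) /\
    (oct_integral (oct_half + x) /\ oct_integral y) /\
    oct_imaginary (oct_mul (oct_half + oct_conj x) y) /\
    oct_norm (oct_half + x) = 1 /\
    oct_norm y = 1] #= `I_4032.
Proof.
set S := (X in X #= _); suff -> : S = [set` solutions].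
  by rewrite -size_solutions; exact: card_eq_seq solutions_uniq.
have half_re : oct_half 0 0 = 1 / 2 by rewrite !mxE /=; field.
have ortho u v : oct_imaginary (oct_mul (oct_conj (halves u)) (halves v)) <->
    dot u v = 0.
  rewrite /oct_imaginary re_conj_mul dot_halves.
  by split=> [eq0|-> //]; apply: (intr_inj (R := rat)); lra.
apply/seteqP; split=> [[x y]|p] /=.
  move=> [[x_im y_im] [[x_int y_int] [xy_im [x_unit y_unit]]]].
  have [u uR eq_u] := (integral_unitP _).1 (conj x_int x_unit).
  have [v vR eq_v] := (integral_unitP _).1 (conj y_int y_unit).
  apply/allpairsPdep; exists u, v; split.
  - rewrite mem_filter uR andbT; apply/eqP/re_halves.
    by rewrite -eq_u mxE half_re x_im addr0.
  - rewrite mem_filter vR andbT; apply/andP; split; apply/eqP.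
      by apply/re_halves; rewrite -eq_v y_im mul0r.
    by apply/ortho; rewrite -eq_u -eq_v -half_conj.
  - by rewrite -eq_u -eq_v addrAC subrr add0r.
case/allpairsPdep => u [v []].
rewrite mem_filter => /andP[/eqP/re_halves u_re uR].
rewrite mem_filter => /andP[/andP[/eqP/re_halves v_re /eqP/ortho uv_im] vR] ->.
have [u_int u_unit] := (integral_unitP _).2 (ex_intro2 _ _ u uR erefl).
have [v_int v_unit] := (integral_unitP _).2 (ex_intro2 _ _ v vR erefl).
have z_eq : oct_half + (halves u - oct_half) = halves u by rewrite addrC subrK.
rewrite /S /= half_conj z_eq; do !split=> //.
by rewrite /oct_imaginary mxE u_re mxE half_re subrr.
Qed.
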